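(* Let $X_1,\ldots,X_m\subseteq[N]$ be a training set, let $a_i=|\{j:i\in X_j\}|$ for $i\in[N]$ and $a_{max}=\max_{i\in[N]}a_i$. Let $K$ be the $N\times N$ diagonal matrix with $K_{ii}=a_i/m$ (the output of the algorithm DiagonalKernel), let $\ell=\ell(K)$, and let $\ell^*$ be the optimal log likelihood achieved by a DPP marginal kernel on the same training set. Then \[\ell\le\left(1+\frac{1}{\log(m/a_{max})}\right)\ell^*.\] Consequently $\ell\le\left(1+\frac{1+o(1)}{\log N}\right)\ell^*$ when $a_{max}=O(m)/N$. Moreover, unconditionally, $\ell\le\left(1+\left(1+\frac{1}{m-1}\right)\log m\right)\ell^*$.
   Context: A marginal kernel on $[N]$ is a real symmetric $N\times N$ matrix $K$ with all eigenvalues in $[0,1]$; it defines the DPP $\mathcal{P}_K$ on subsets of $[N]$ with $\Pr_{\boldsymbol{Y}\sim\mathcal{P}_K}[S\subseteq\boldsymbol{Y}]=\det(K_S)$ for all $S\subseteq[N]$. The log likelihood is defined with a minus sign: $\ell(K)=-\frac1m\sum_{j=1}^m\log\Pr_{\boldsymbol{Y}\sim\mathcal{P}_K}[\boldsymbol{Y}=X_j]$ (natural log), and $\ell^*=\min_K\ell(K)$ over all marginal kernels. *)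

(* Defs.v *)
From HB Require Import structures.
From mathcomp Require Import all_boot all_order all_algebra.
From mathcomp Require Import all_classical all_reals all_analysis.

Set Implicit Arguments.
Unset Strict Implicit.
Unset Printing Implicit Defensive.

Import Order.TTheory GRing.Theory Num.Theory.
Import numFieldNormedType.Exports.

Local Open Scope ring_scope.

Section DPP.
Variables (R : realType) (N : nat).

Definition marginal_kernel (K : 'M[R]_N) : Prop :=
  K^T = K /\ forall a : R, eigenvalue K a -> 0 <= a <= 1.

(* K_S; its determinant is 1 when S is empty. *)
Definition principal_submx (K : 'M[R]_N) (S : {set 'I_N}) : 'M[R]_#|S| :=
  mxsub (@enum_val _ (mem S)) (@enum_val _ (mem S)) K.

Definition is_dpp (K : 'M[R]_N) (p : {ffun {set 'I_N} -> R}) : Prop :=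
  [/\ forall Y, 0 <= p Y,
      \sum_Y p Y = 1
    & forall S : {set 'I_N},
        \sum_(Y : {set 'I_N} | S \subset Y) p Y = \det (principal_submx K S)].

(* The inclusion probabilities determine the distribution. *)
Lemma is_dpp_unique (K : 'M[R]_N) (p q : {ffun {set 'I_N} -> R}) :
  is_dpp K p -> is_dpp K q -> p = q.
Proof.
move=> [_ _ pK] [_ _ qK]; apply/ffunP => S.
have [n] := ubnP (N - #|S|)%N; elim: n S => // n IH S leSn.
have := etrans (pK S) (esym (qK S)).
rewrite (bigD1 S) //= [in X in _ = X -> _](bigD1 S) //=.
rewrite (eq_bigr q) => [/addIr //|Y /andP[SY neqY]].
apply: IH; have ltSY : (#|S| < #|Y|)%N.
  by apply: proper_card; rewrite finset.properEneq eq_sym neqY.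
have leYN : (#|Y| <= N)%N by rewrite -[X in (_ <= X)%N]card_ord max_card.
by apply: leq_trans (_ : (N - #|S| <= n)%N); [rewrite ltn_sub2l // (leq_trans ltSY)|].
Qed.

(* Pr_{Y ~ P_K}[Y = X] is [dpp K X]; every marginal kernel K has a DPP, so the
   default value 0 plays no role for such K. *)
Definition dpp (K : 'M[R]_N) : {ffun {set 'I_N} -> R} := xget 0 (is_dpp K).

Variables (m : nat) (X : 'I_m -> {set 'I_N}).

(* Extended-real valued: [lne 0 = -oo], so the value is +oo as soon as some
   training set has probability 0. *)
Definition log_likelihood (K : 'M[R]_N) : \bar R :=
  (- ((m%:R^-1)%:E * \sum_(j < m) lne (dpp K (X j))%:E))%E.

Definition opt_log_likelihood : \bar R :=
  ereal_inf [set log_likelihood K | K in marginal_kernel]%classic.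

Definition occurrences (i : 'I_N) : nat := #|[pred j : 'I_m | i \in X j]|.

Definition max_occurrences : nat := (\max_(i < N) occurrences i)%N.

Definition diagonal_kernel : 'M[R]_N :=
  diag_mx (\row_(i < N) ((occurrences i)%:R / m%:R)).

End DPP.

(* Main.v *)
Require Import Defs.
From HB Require Import structures.
From mathcomp Require Import all_boot all_order all_algebra.
From mathcomp Require Import all_classical all_reals all_analysis.
From mathcomp Require Import ring lra fintype finset.

(**
Write [q_i = a_i / m] for the empirical frequencies and [E = - \sum_i q_i ln q_i].
The diagonal kernel has cost [\sum_i H(q_i)] with
[H(q) = - q ln q - (1 - q) ln (1 - q)], so everything follows from scalar
estimates of [- (1 - q) ln (1 - q)] by [- q ln q] once [E <= l*] is known.

For [E <= l*], let [p] be the law of a DPP with symmetric kernel and tilt it by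
positive weights, [p_z(Y) ~ p(Y) \prod_(i in Y) z_i]. The unnormalised inclusion
masses of [p_z] are determinants, and symmetry of the kernel makes them
log-submodular; hence [p_z(X) <= \prod_(i in X) mu_i] with [mu_i] the marginals
of [p_z]. If [z] nearly maximises the likelihood of the training set among all
tilts, then each [mu_i] is at most nearly [q_i], so
[\sum_j ln p(X_j) <= sup_z \sum_j ln p_z(X_j) <= \sum_i a_i ln q_i].
*)

Set Implicit Arguments.
Unset Strict Implicit.
Unset Printing Implicit Defensive.

Import Order.TTheory GRing.Theory Num.Theory.
Import numFieldNormedType.Exports.

Local Open Scope ring_scope.

(** * Determinant identities *)

(** Sylvester's identity: the same two block matrices, multiplied in either order, give block
    triangular products whose determinants are the two sides. *)
Lemma det_add1_mulmx (R : comNzRingType) (m n : nat)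
    (A : 'M[R]_(m, n)) (B : 'M[R]_(n, m)) :
  \det (1%:M + A *m B) = \det (1%:M + B *m A).
Proof.
have e1 : block_mx 1%:M (- A) B 1%:M *m block_mx 1%:M A 0 1%:M
    = block_mx 1%:M 0 B (1%:M + B *m A) :> 'M[R]_(m + n).
  by rewrite mulmx_block !mulmx1 !mulmx0 !mul1mx !addr0 subrr addrC.
have e2 : block_mx 1%:M A 0 1%:M *m block_mx 1%:M (- A) B 1%:M
    = block_mx (1%:M + A *m B) 0 B 1%:M :> 'M[R]_(m + n).
  by rewrite mulmx_block !mulmx1 !mul0mx !mul1mx !add0r addNr.
have := congr1 determinant e1; have := congr1 determinant e2.
by rewrite !det_mulmx !det_ublock !det_lblock !det1 !mul1r !mulr1 => -> ->.
Qed.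

Lemma det_mx22E (R : comNzRingType) (A : 'M[R]_2) :
  \det A = A ord0 ord0 * A ord_max ord_max - A ord0 ord_max * A ord_max ord0.
Proof.
rewrite (expand_det_row _ ord0) !big_ord_recl big_ord0 /cofactor !det_mx11 !mxE /=.
rewrite addr0 expr0 expr1 mul1r mulN1r mulrN.
by congr (A _ _ * A _ _ - A _ _ * A _ _); apply/val_inj.
Qed.

(** * Matrices encoding tilted inclusion masses *)

Section Tilt.
Variables (R : fieldType) (n : nat) (K : 'M[R]_n) (z : 'I_n -> R).

(* Its determinant is [\sum_(Y >= S) p(Y) \prod_(k in A :&: Y) z k] when [p] is
   the DPP of [K] and [S], [A] are disjoint: see [tilted_mass_det]. *)
Definition tilt_mx (S A : {set 'I_n}) : 'M[R]_n := \matrix_(k, l)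
  if k \in S then K k l
  else (k == l)%:R + (if k \in A then (z k - 1) * K k l else 0).

(** The determinant is linear in row [i], which is [e_i + (z i - 1) * K_i] on the left and [e_i],
    respectively [K_i], on the right. *)
Lemma det_tilt_mx_setU1 (S A : {set 'I_n}) (i : 'I_n) :
  i \notin S -> i \notin A ->
  \det (tilt_mx S (i |: A)) =
  \det (tilt_mx S A) + (z i - 1) * \det (tilt_mx (i |: S) A).
Proof.
move=> iS iA; rewrite -[\det (tilt_mx S A)]mul1r.
apply: (determinant_multilinear (i0 := i)).
- apply/rowP => l; rewrite !mxE !in_setU1 !eqxx (negPf iS) (negPf iA) /=.
  by rewrite addr0 mul1r.
- apply/matrixP => k l; rewrite !mxE !in_setU1.
  by rewrite [_ == i]eq_sym (negPf (neq_lift _ _)).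
- apply/matrixP => k l; rewrite !mxE !in_setU1.
  by rewrite [_ == i]eq_sym (negPf (neq_lift _ _)).
Qed.

(** Rows outside [S] are unit rows, so the matrix perturbs the identity only through the coordinate
    restriction [P] to [S]; Sylvester's identity brings it down to size [#|S|]. *)
Lemma det_tilt_mx0 (S : {set 'I_n}) :
  \det (tilt_mx S set0) =
  \det (mxsub (@enum_val _ (mem S)) (@enum_val _ (mem S)) K).
Proof.
pose P : 'M[R]_(#|S|, n) := rowsub (@enum_val _ (mem S)) 1%:M.
have PE (A : 'M[R]_n) : P *m A *m P^T =
    mxsub (@enum_val _ (mem S)) (@enum_val _ (mem S)) A.
  have -> : P *m A = rowsub (@enum_val _ (mem S)) A.
    by rewrite mul_rowsub_mx mul1mx.
  rewrite -[LHS]trmxK trmx_mul trmxK mul_rowsub_mx mul1mx.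
  by apply/matrixP => a b; rewrite !mxE.
have -> : tilt_mx S set0 = 1%:M + P^T *m (P *m (K - 1%:M)).
  apply/matrixP => k l; rewrite mulmxA !mxE in_set0 addr0.
  have PP (x : 'I_n) : (P^T *m P) k x = ((k == x) && (k \in S))%:R.
    rewrite mxE; have [kS|kS] := boolP (k \in S); rewrite ?andbT ?andbF.
      rewrite (bigD1 (enum_rank_in kS k)) //= big1 ?addr0.
        by rewrite !mxE enum_rankK_in // eqxx mul1r.
      move=> a; rewrite !mxE => aN.
      case: eqP => [e|]; last by rewrite mul0r.
      by case/eqP: aN; apply: enum_val_inj; rewrite enum_rankK_in.
    rewrite big1 // => a _; rewrite !mxE; case: eqP => [e|]; last by rewrite mul0r.
    by have := enum_valP a; rewrite e (negPf kS).
  rewrite (bigD1 k) //= big1 ?addr0; last first.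
    by move=> x; rewrite PP eq_sym => /negPf ->; rewrite mul0r.
  rewrite PP eqxx /= !mxE; case: (k \in S); rewrite ?mul0r ?addr0 // mul1r.
  by rewrite addrC subrK.
rewrite det_add1_mulmx PE; congr (\det _); apply/matrixP => a b.
by rewrite !mxE (inj_eq enum_val_inj) addrC subrK.
Qed.

(** This is where symmetry of the kernel enters: it makes the product of off-diagonal entries
    [V i j * V j i] in the submodularity proof a square. *)
Lemma invmx_tilt_sym (S A : {set 'I_n}) (i j : 'I_n) :
  K^T = K -> tilt_mx S A \in unitmx -> i \in S -> j \in S ->
  invmx (tilt_mx S A) i j = invmx (tilt_mx S A) j i.
Proof.
move=> Ks Mu iS jS; set M := tilt_mx S A; set V := invmx M.
pose W : 'M[R]_n := diag_mx (\row_k if k \in S then 1 else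
  if k \in A then z k - 1 else 0).
(* [M *m W] is symmetric, and [W] is the identity on [S]. *)
have MW : M *m W = W *m M^T.
  apply/matrixP => k l; rewrite mul_mx_diag mul_diag_mx !mxE.
  have -> : K l k = K k l by rewrite -[in LHS]Ks mxE.
  rewrite [l == k]eq_sym; case: eqP => [<-|_]; first by rewrite mulrC.
  case: (k \in S); case: (l \in S); case: (k \in A); case: (l \in A);
    by rewrite /= ?mulr0n; ring.
have VW : V *m W = W *m V^T.
  have := congr1 (fun B => V *m B *m V^T) MW.
  rewrite /= !mulmxA mulVmx // mul1mx => ->.
  by rewrite -[_ *m _ *m V^T]mulmxA -trmx_mul mulVmx // trmx1 mulmx1.
have /matrixP/(_ i j) := VW.
by rewrite mul_mx_diag mul_diag_mx !mxE iS jS mulr1 mul1r.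
Qed.

(** Only the rows [s c] change, so Sylvester's identity leaves an [r] by [r] determinant in entries
    of the inverse. *)
Lemma det_tilt_update (r : nat) (s : 'I_r -> 'I_n) (S T A : {set 'I_n}) :
  injective s -> tilt_mx T A \in unitmx ->
  (forall k, k \notin codom s -> (k \in S) = (k \in T)) ->
  (forall c, s c \in T) -> (forall c, s c \notin S) ->
  \det (tilt_mx S ([set s c | c : 'I_r] :|: A)) = \det (tilt_mx T A) *
    \det (\matrix_(c, d) ((z (s c) - 1) *+ (c == d) +
                           invmx (tilt_mx T A) (s c) (s d))).
Proof.
move=> s_inj Mu ST sT sS; set M := tilt_mx T A; set V := invmx M.
pose U : 'M[R]_(n, r) := \matrix_(k, c) (k == s c)%:R.
(* Row [s c] passes from [K] to a unit row plus [(z - 1) * K]; the difference carries the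
   coefficient [z - 2]. *)
pose B : 'M[R]_(r, n) :=
  \matrix_(c, l) ((s c == l)%:R + (z (s c) - 2) * M (s c) l).
have -> : tilt_mx S ([set s c | c : 'I_r] :|: A) = M *m (1%:M + (V *m U) *m B).
  rewrite mulmxDr mulmx1 !mulmxA mulmxV // mul1mx.
  apply/matrixP => k l; rewrite !mxE in_setU.
  have [/codomP[c ->]|kN] := boolP (k \in codom s).
    rewrite (bigD1 c) //= big1 ?addr0; last first.
      by move=> d dc; rewrite !mxE (inj_eq s_inj) eq_sym (negPf dc) mul0r.
    rewrite !mxE eqxx mul1r imset_f //= (negPf (sS c)) !sT addrCA.
    by ring.
  rewrite big1 ?addr0; last first.
    move=> d _; rewrite !mxE; case: eqP => [e|]; last by rewrite mul0r.
    by case/negP: kN; rewrite e codom_f.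
  rewrite ST //; have -> // : (k \in [set s c | c : 'I_r]) = false.
  by apply/negP => /imsetP[c _ e]; case/negP: kN; rewrite e codom_f.
rewrite det_mulmx det_add1_mulmx; congr (_ * \det _).
have -> : B *m (V *m U) = \matrix_(c, d) (B *m V) c (s d).
  rewrite mulmxA; apply/matrixP => c d; rewrite !mxE (bigD1 (s d)) //= big1 ?addr0.
    by rewrite !mxE eqxx mulr1.
  by move=> k /negPf kd; rewrite !mxE kd mulr0.
have -> : B *m V = rowsub s V + (\matrix_(c, l) ((z (s c) - 2) *+ (s c == l))).
  have -> : B = rowsub s 1%:M + diag_mx (\row_c (z (s c) - 2)) *m rowsub s M.
    by apply/matrixP => c l; rewrite mul_diag_mx !mxE.
  rewrite mulmxDl -mulmxA !mul_rowsub_mx mul1mx mulmxV //; congr (_ + _).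
  by apply/matrixP => c l; rewrite mul_diag_mx !mxE mulr_natr.
apply/matrixP => c d; rewrite !mxE (inj_eq s_inj) addrCA addrC; congr (_ + _).
case: (c == d); last by rewrite !mulr0n addr0.
by rewrite !mulr1n; ring.
Qed.
End Tilt.

(** * Tilted inclusion masses and their log-submodularity *)

Section TiltedMass.
Variables (R : realType) (N : nat) (K : 'M[R]_N) (p : {ffun {set 'I_N} -> R}).
Hypotheses (Ksym : K^T = K) (pK : is_dpp K p).
Variable z : 'I_N -> R.

(** Restricting the weights to [A] lets them be introduced one at a time; [A = setT] gives the
    unnormalised inclusion probability of the tilted law. *)
Definition tilted_mass (S A : {set 'I_N}) : R :=
  \sum_(Y : {set 'I_N} | S \subset Y) p Y * \prod_(k in A :&: Y) z k.

(** Both sides obey the same recursion in [A]: for the mass, write [z i = 1 + (z i - 1)] on the sets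
    containing [i]. *)
Lemma tilted_mass_det (S A : {set 'I_N}) :
  [disjoint S & A] -> tilted_mass S A = \det (tilt_mx K z S A).
Proof.
have [n] := ubnP #|A|; elim: n S A => // n IH S A leAn dSA.
have [A0|[i iA]] := set_0Vmem A.
  rewrite A0 det_tilt_mx0; case: pK => _ _ /(_ S) <-.
  by apply: eq_bigr => Y _; rewrite set0I big_set0 mulr1.
have iS : i \notin S by rewrite (disjointFl dSA).
have ltA : (#|A :\ i| < n)%N by move: leAn; rewrite (cardsD1 i A) iA.
have dS : [disjoint S & A :\ i].
  by apply: disjointWr dSA; rewrite subsetDl.
have dSi : [disjoint i |: S & A :\ i].
  by rewrite disjoints_subset subUset sub1set !inE eqxx /= -disjoints_subset.
rewrite -(setD1K iA) det_tilt_mx_setU1 ?setD11 // -!IH // /tilted_mass.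
rewrite mulr_sumr.
have -> : \sum_(Y : {set 'I_N} | i |: S \subset Y)
      (z i - 1) * (p Y * \prod_(k in (A :\ i) :&: Y) z k) =
    \sum_(Y : {set 'I_N} | S \subset Y) (i \in Y)%:R *
      ((z i - 1) * (p Y * \prod_(k in (A :\ i) :&: Y) z k)).
  rewrite [RHS](bigID (fun Y : {set 'I_N} => i \in Y)) /= [X in _ = _ + X]big1 ?addr0.
    apply: eq_big => [Y|Y]; first by rewrite subUset sub1set andbC.
    by rewrite subUset sub1set => /andP[-> _]; rewrite mul1r.
  by move=> Y /andP[_ /negPf ->]; rewrite mul0r.
rewrite -big_split /=; apply: eq_bigr => Y _.
have [iY|iY] := boolP (i \in Y).
  rewrite setIUl (setIidPl _) ?sub1set //.
  rewrite big_setU1 ?in_setI ?setD11 //=; ring.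
rewrite mul0r addr0 setIUl; have -> : [set i] :&: Y = set0.
  by apply/setP => k; rewrite !inE; case: eqP => // ->; rewrite (negPf iY).
by rewrite set0U.
Qed.

Hypothesis z_gt0 : forall k, 0 < z k.

Lemma tilted_mass_ge0 S A : 0 <= tilted_mass S A.
Proof.
case: pK => p0 _ _; apply: sumr_ge0 => Y _; apply: mulr_ge0 => //.
by apply: prodr_ge0 => k _; apply: ltW.
Qed.

(** Pulling out the weights on [S] leaves the disjoint pair that [tilted_mass_det] requires. *)
Lemma tilted_massT S :
  tilted_mass S setT = (\prod_(k in S) z k) * tilted_mass S (~: S).
Proof.
rewrite /tilted_mass mulr_sumr; apply: eq_bigr => Y SY.
rewrite setTI mulrCA; congr (_ * _).
rewrite (big_setID S) /= (setIidPr SY); congr (_ * _).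
by apply: eq_bigl => k; rewrite !inE.
Qed.

(** All four masses are expressed through the matrix at [T] and its inverse [V]; the difference of
    the two sides is then a nonnegative multiple of [V i j ^+ 2]. *)
Lemma tilted_mass_submodular (S : {set 'I_N}) (i j : 'I_N) :
  i \notin S -> j \notin S -> i != j ->
  tilted_mass (i |: (j |: S)) setT * tilted_mass S setT <=
  tilted_mass (i |: S) setT * tilted_mass (j |: S) setT.
Proof.
move=> iS jS ij; rewrite !tilted_massT; set T := i |: (j |: S).
have ji : j != i by rewrite eq_sym.
have iTS : i \notin j |: S by rewrite in_setU1 negb_or ij.
have jTS : j \notin i |: S by rewrite in_setU1 negb_or ji.
rewrite !big_setU1 //=; set zS := \prod_(k in S) z k.
have zS0 : 0 <= zS by apply: prodr_ge0 => k _; exact: ltW.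
have zi := ltW (z_gt0 i); have zj := ltW (z_gt0 j).
(* If the mass at [T] vanishes, so does the left side; otherwise the matrix at [T] is invertible. *)
have [T0|TN0] := eqVneq (tilted_mass T (~: T)) 0.
  by rewrite T0 !mulr0 mul0r !mulr_ge0 ?tilted_mass_ge0.
have disC (B : {set 'I_N}) : [disjoint B & ~: B].
  by rewrite disjoints_subset setCK.
rewrite !tilted_mass_det //.
rewrite tilted_mass_det // in TN0.
have Mu : tilt_mx K z T (~: T) \in unitmx by rewrite unitmxE unitfE.
set V := invmx (tilt_mx K z T (~: T)).
have iT : i \in T by rewrite !inE eqxx.
have jT : j \in T by rewrite !inE eqxx orbT.
have ord1_inj (k : 'I_N) : injective (fun _ : 'I_1 => k).
  by move=> a b _; rewrite (ord1 a) (ord1 b).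
have eS1 (k : 'I_N) : [set (fun _ : 'I_1 => k) c | c : 'I_1] = [set k].
  apply/setP => l; rewrite !inE; apply/imsetP/eqP => [[]//|->].
  by exists ord0.
have cod1 (k l : 'I_N) : l \notin codom (fun _ : 'I_1 => k) -> l != k.
  by apply: contraNN => /eqP ->; apply/codomP; exists ord0.
have Ei : \det (tilt_mx K z (i |: S) (~: (i |: S))) =
    \det (tilt_mx K z T (~: T)) * (z j - 1 + V j j).
  have -> : ~: (i |: S) = [set (fun _ : 'I_1 => j) c | c : 'I_1] :|: ~: T.
    rewrite eS1; apply/setP => k; rewrite !inE.
    by have [->|] := eqVneq k j; rewrite ?(negPf ji) ?(negPf jS).
  rewrite (@det_tilt_update _ _ _ _ 1 (fun _ => j) _ T) //.
  - by rewrite det_mx11 !mxE eqxx mulr1n.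
  - by move=> k /cod1 kj; rewrite !inE (negPf kj).
have Ej : \det (tilt_mx K z (j |: S) (~: (j |: S))) =
    \det (tilt_mx K z T (~: T)) * (z i - 1 + V i i).
  have -> : ~: (j |: S) = [set (fun _ : 'I_1 => i) c | c : 'I_1] :|: ~: T.
    rewrite eS1; apply/setP => k; rewrite !inE.
    by have [->|] := eqVneq k i; rewrite ?(negPf ij) ?(negPf iS).
  rewrite (@det_tilt_update _ _ _ _ 1 (fun _ => i) _ T) //.
  - by rewrite det_mx11 !mxE eqxx mulr1n.
  - by move=> k /cod1 ki; rewrite !inE (negPf ki).
have E0 : \det (tilt_mx K z S (~: S)) = \det (tilt_mx K z T (~: T)) *
    ((z i - 1 + V i i) * (z j - 1 + V j j) - V i j * V j i).
  pose s (c : 'I_2) := if c == ord0 then i else j.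
  have -> : ~: S = [set s c | c : 'I_2] :|: ~: T.
    apply/setP => k; rewrite !inE.
    have -> : (k \in [set s c | c : 'I_2]) = (k == i) || (k == j).
      apply/imsetP/orP => [[c _ ->]|[/eqP ->|/eqP ->]].
      - by rewrite /s; case: ifP => _; rewrite eqxx; [left|right].
      - by exists ord0.
      - by exists ord_max.
    have [->|] := eqVneq k i; first by rewrite iS.
    by have [->|] := eqVneq k j; first by rewrite jS.
  rewrite (@det_tilt_update _ _ _ _ 2 s _ T) //.
  - by rewrite det_mx22E !mxE /s /= !mulr1n !mulr0n !add0r.
  - move=> a b; rewrite /s; case: eqP => [->|/eqP a0]; case: eqP => [->|/eqP b0] // e.
    + by move: ij; rewrite e eqxx.
    + by move: ij; rewrite e eqxx.
    + apply/val_inj; case: a a0 {e} => -[|[|?]] //= ?; by case: b b0 => -[|[|?]].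
  - move=> k kN; have ki : k != i.
      by apply: contraNN kN => /eqP ->; apply/codomP; exists ord0.
    have kj : k != j.
      by apply: contraNN kN => /eqP ->; apply/codomP; exists ord_max.
    by rewrite !inE (negPf ki) (negPf kj).
  - by move=> c; rewrite /s; case: eqP.
  - by move=> c; rewrite /s; case: eqP.
have Vs : V j i = V i j by apply: invmx_tilt_sym.
rewrite Ei Ej E0 Vs -subr_ge0.
set D := \det _.
rewrite [leRHS](_ : _ = (z i * z j) * (zS * D * V i j) ^+ 2); last by ring.
by apply: mulr_ge0 (sqr_ge0 _); exact: mulr_ge0.
Qed.

End TiltedMass.

Lemma sum_occurrences (R : realType) (N m : nat) (X : 'I_m -> {set 'I_N})
    (c : 'I_N -> R) :
  \sum_(j < m) \sum_(i in X j) c i = \sum_(i < N) (occurrences X i)%:R * c i.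
Proof.
rewrite (exchange_big_dep predT) //=; apply: eq_bigr => i _.
by rewrite sumr_const mulr_natl.
Qed.

(** * Negative dependence of the tilted law *)

Section NegativeDependence.
Variables (R : realType) (N : nat) (K : 'M[R]_N) (p : {ffun {set 'I_N} -> R}).
Hypotheses (Ksym : K^T = K) (pK : is_dpp K p).
Variables (z : 'I_N -> R) (X : {set 'I_N}).
Hypotheses (z_gt0 : forall k, 0 < z k) (pX : 0 < p X).

Local Notation g S := (tilted_mass p z S setT).

Lemma tilted_mass_ge (S : {set 'I_N}) :
  S \subset X -> p X * \prod_(k in X) z k <= g S.
Proof.
move=> SX; rewrite /tilted_mass (bigD1 X) //= setTI lerDl.
apply: sumr_ge0 => Y _; apply: mulr_ge0; first by case: pK.
by apply: prodr_ge0 => k _; exact: ltW.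
Qed.

Lemma tilted_mass_gt0 (S : {set 'I_N}) : S \subset X -> 0 < g S.
Proof.
move/tilted_mass_ge; apply: lt_le_trans; apply: mulr_gt0 => //.
by apply: prodr_gt0 => k _.
Qed.

(** Induction on [#|S|]: submodularity removes one element [j], the induction hypothesis the others.
    The positive mass of [X] allows [g S'] to be cancelled. *)
Lemma tilted_mass_setU1_le (S : {set 'I_N}) (i : 'I_N) :
  i \notin S -> i |: S \subset X -> g (i |: S) * g set0 <= g S * g [set i].
Proof.
have [n] := ubnP #|S|; elim: n S => // n IH S leSn iS iSX.
have [->|[j jS]] := set_0Vmem S; first by rewrite setU0 mulrC.
have ij : i != j by apply: contraNneq iS => ->.
pose S' := S :\ j; have SE : j |: S' = S := setD1K jS.
have iS' : i \notin S' by rewrite !inE negb_and iS orbT.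
have S'S : S' \subset S := subsetDl _ _.
have SX : S \subset X by move: iSX; rewrite subUset => /andP[].
have iS'X : i |: S' \subset X by apply: subset_trans iSX; exact: setUS.
have ltS : (#|S'| < n)%N by move: leSn; rewrite (cardsD1 j S) jS.
have IH' := IH _ ltS iS' iS'X.
have jS' : j \notin S' by rewrite setD11.
have := tilted_mass_submodular Ksym pK z_gt0 iS' jS' ij; rewrite SE => sub.
have g' : 0 < g S' by apply: tilted_mass_gt0; exact: subset_trans SX.
have gS : 0 < g S by apply: tilted_mass_gt0.
have g0 : 0 < g set0 by apply: tilted_mass_gt0; exact: sub0set.
rewrite -(ler_pM2r g').
have h1 := ler_wpM2r (ltW g0) sub; have h2 := ler_wpM2l (ltW gS) IH'.
move: h1 h2; lra.
Qed.

(** When [S] is built up one element at a time, each element multiplies the mass by at most its own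
    marginal. *)
Lemma ln_tilted_mass_le (S : {set 'I_N}) : S \subset X ->
  ln (g S) - ln (g set0) <= \sum_(i in S) (ln (g [set i]) - ln (g set0)).
Proof.
have [n] := ubnP #|S|; elim: n S => // n IH S leSn SX.
have [->|[i iS]] := set_0Vmem S; first by rewrite big_set0 subrr.
have iS' : i \notin S :\ i by rewrite setD11.
have S'X : S :\ i \subset X by apply: subset_trans SX; exact: subsetDl.
have ltS : (#|S :\ i| < n)%N by move: leSn; rewrite (cardsD1 i S) iS.
have := IH _ ltS S'X; rewrite (big_setD1 i iS) /=.
have g' : 0 < g (S :\ i) by apply: tilted_mass_gt0.
have gS : 0 < g S by apply: tilted_mass_gt0.
have g0 : 0 < g set0 by apply: tilted_mass_gt0; exact: sub0set.
have gi : 0 < g [set i].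
  by apply: tilted_mass_gt0; rewrite sub1set (subsetP SX).
have := tilted_mass_setU1_le iS'; rewrite setD1K // => /(_ SX).
rewrite -ler_ln ?posrE ?mulr_gt0 // !lnM ?posrE //.
lra.
Qed.

End NegativeDependence.

(** * Likelihood bound by near-maximisation over tilts *)

Section KeyBound.
Variables (R : realType) (N m : nat) (X : 'I_m -> {set 'I_N}).
Variables (K : 'M[R]_N) (p : {ffun {set 'I_N} -> R}).
Hypotheses (Ksym : K^T = K) (pK : is_dpp K p).
Hypotheses (m_gt0 : (0 < m)%N) (pX : forall j, 0 < p (X j)).

Local Notation a i := (occurrences X i)%:R.
Local Notation Z t := (fun k => expR (t k)).
Local Notation g t S := (tilted_mass p (Z t) S setT).

Let Z_gt0 (t : 'I_N -> R) k : 0 < Z t k. Proof. exact: expR_gt0. Qed.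

Let j0 : 'I_m := Ordinal m_gt0.

Let g0_gt0 t : 0 < g t set0.
Proof. exact: (tilted_mass_gt0 pK (Z_gt0 t) (pX j0) (sub0set _)). Qed.

(** This is [\sum_j ln p_z(X_j)] for the weights [z = expR t], with [g t set0] as normalising
    constant. *)
Definition tilted_loglik (t : 'I_N -> R) : R :=
  \sum_(j < m) ln (p (X j)) + \sum_(i < N) a i * t i - m%:R * ln (g t set0).

Let loglikE t : tilted_loglik t =
  \sum_(j < m) (ln (p (X j)) + \sum_(i in X j) t i - ln (g t set0)).
Proof.
rewrite /tilted_loglik -sum_occurrences -big_split /= sumrB; congr (_ - _).
by rewrite sumr_const card_ord mulr_natl.
Qed.

Let ln_tilted t j :
  ln (p (X j)) + \sum_(i in X j) t i = ln (p (X j) * \prod_(k in X j) Z t k).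
Proof.
rewrite lnM ?posrE ?prodr_gt0 //; congr (_ + _).
by rewrite -expR_sum expRK.
Qed.

(** The tilted probability of [X j] is at most its inclusion probability, which negative dependence
    bounds by the product of marginals. *)
Lemma tilted_loglik_le t :
  tilted_loglik t <= \sum_(i < N) a i * (ln (g t [set i]) - ln (g t set0)).
Proof.
rewrite -sum_occurrences loglikE; apply: ler_sum => j _.
apply: le_trans (ln_tilted_mass_le Ksym pK (Z_gt0 t) (pX j) (subxx _)).
rewrite lerD2r ln_tilted ler_ln ?posrE ?mulr_gt0 ?prodr_gt0 //.
  exact: (tilted_mass_ge pK (Z_gt0 t) (subxx _)).
exact: (tilted_mass_gt0 pK (Z_gt0 t) (pX j) (subxx _)).
Qed.

(** Probabilities are at most 1; this makes the supremum over all tilts finite. *)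
Lemma tilted_loglik_le0 t : tilted_loglik t <= 0.
Proof.
rewrite loglikE; apply: sumr_le0 => j _.
rewrite subr_le0 ln_tilted ler_ln ?posrE ?mulr_gt0 ?prodr_gt0 //.
exact: (tilted_mass_ge pK (Z_gt0 t) (sub0set _)).
Qed.

Lemma tilted_mass1_le t i : g t [set i] <= g t set0.
Proof.
rewrite /tilted_mass [leRHS](bigID (fun Y : {set 'I_N} => [set i] \subset Y)) /=.
under [X in _ <= X + _]eq_bigl => Y do rewrite sub0set.
rewrite lerDl; apply: sumr_ge0 => Y _; apply: mulr_ge0; first by case: pK.
by apply: prodr_ge0 => k _; exact: expR_ge0.
Qed.

(** Only the sets containing [i] see the changed weight, which is multiplied by [1 - h]. *)
Lemma tilted_mass_shrink t i (h : R) : h < 1 ->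
  g (fun k => t k + (if k == i then ln (1 - h) else 0)) set0 =
  g t set0 - h * g t [set i].
Proof.
move=> h1; have h1' : 0 < 1 - h by rewrite subr_gt0.
rewrite /tilted_mass mulr_sumr.
rewrite [X in _ = _ - X](_ : _ = \sum_(Y : {set 'I_N} | set0 \subset Y)
    (i \in Y)%:R * (h * (p Y * \prod_(k in setT :&: Y) Z t k))); last first.
  rewrite [RHS](bigID (fun Y : {set 'I_N} => i \in Y)) /= [X in _ = _ + X]big1 ?addr0.
    apply: eq_big => [Y|Y]; first by rewrite sub0set sub1set.
    by rewrite sub1set => ->; rewrite mul1r.
  by move=> Y /andP[_ /negPf ->]; rewrite mul0r.
rewrite -sumrB; apply: eq_bigr => Y _; rewrite setTI.
have [iY|iY] := boolP (i \in Y).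
  rewrite (big_setD1 i iY) /= [X in _ = _ * X - _](big_setD1 i iY) /=.
  rewrite [X in _ = _ - _ * (_ * (_ * X))](big_setD1 i iY) /=.
  rewrite eqxx expRD lnK ?posrE //.
  rewrite (eq_bigr (Z t)); first by ring.
  by move=> k; rewrite !inE => /andP[/negPf -> _]; rewrite addr0.
rewrite mul0r subr0; congr (_ * _); apply: eq_bigr => k kY.
by case: eqP kY => [->|_ _]; [rewrite (negPf iY)|rewrite addr0].
Qed.

(* Shrinking one weight by [1 - h] cannot raise a nearly maximal tilted
   likelihood by much; to first order in [h] this bounds the marginal of [i]. *)
Lemma near_max_marginal t i (h : R) : 0 < h -> h < 1 ->
  (forall t', tilted_loglik t' <= tilted_loglik t + h ^+ 2) ->
  m%:R * (g t [set i] / g t set0) <= h + a i / (1 - h).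
Proof.
move=> h0 h1 /(_ (fun k => t k + (if k == i then ln (1 - h) else 0))).
set mu := g t [set i] / _.
have h1' : 0 < 1 - h by rewrite subr_gt0.
have mu0 : 0 <= mu.
  by rewrite divr_ge0 ?(tilted_mass_ge0 pK (Z_gt0 t)).
have mu1 : mu <= 1 by rewrite ler_pdivrMr // mul1r tilted_mass1_le.
rewrite /tilted_loglik tilted_mass_shrink //.
have -> : \sum_(k < N) a k * (t k + (if k == i then ln (1 - h) else 0)) =
    \sum_(k < N) a k * t k + a i * ln (1 - h).
  under eq_bigr do rewrite mulrDr.
  rewrite big_split /=; congr (_ + _).
  rewrite (bigD1 i) //= eqxx big1 ?addr0 // => k /negPf ->.
  by rewrite mulr0.
have hmu : h * mu < 1.
  by apply: le_lt_trans h1; rewrite -[leRHS]mulr1 ler_wpM2l // ltW.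
have -> : g t set0 - h * g t [set i] = g t set0 * (1 - h * mu).
  by rewrite /mu; field; rewrite lt0r_neq0.
rewrite lnM ?posrE ?subr_gt0 //.
have l1 : ln (1 - h * mu) <= - (h * mu).
  by apply: le_ln1Dx; rewrite ltrN2.
have l2 : - (h / (1 - h)) <= ln (1 - h).
  rewrite lerNl -lnV ?posrE //.
  rewrite [X in ln X](_ : _ = 1 + h / (1 - h)); last by field; rewrite lt0r_neq0.
  apply: le_ln1Dx; apply: lt_le_trans (_ : 0 <= _); first by rewrite ltrN10.
  by rewrite divr_ge0 // ltW.
have l1' := ler_wpM2l (ler0n R m) l1; have l2' := ler_wpM2l (ler0n R (occurrences X i)) l2.
(* [H] amounts to [a i * ln (1 - h) - m%:R * ln (1 - h * mu) <= h ^+ 2]. The slack is quadratic so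
   that dividing by [h] leaves only an error [h]. *)
move=> H; rewrite -(ler_pM2l h0).
have -> : h * (h + a i / (1 - h)) = h ^+ 2 + a i * (h / (1 - h)).
  by ring.
move: l1' l2' H; lra.
Qed.

(** The supremum over tilts need not be attained, so a tilt within [h ^+ 2] of it is used, with
    total error at most an arbitrary [e]. *)
Lemma sum_ln_dpp_le :
  \sum_(j < m) ln (p (X j)) <= \sum_(i < N) a i * ln (a i / m%:R).
Proof.
have m0 : 0 < m%:R :> R by rewrite ltr0n.
pose E : set R := range tilted_loglik.
have Eub : ubound E 0 by move=> _ [t _ <-]; exact: tilted_loglik_le0.
have Esup : has_sup E.
  by split; [exists (tilted_loglik (fun=> 0)), (fun=> 0)|exists 0].
(* The errors add up to [h ^+ 2 + N * h + 2 * h * \sum_i a i], which is at most [h * C] because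
   [h <= 1]. *)
pose C : R := 1 + N%:R + 2 * \sum_(i < N) a i.
have C_gt0 : 0 < C.
  apply: ltr_wpDr; first by rewrite mulr_ge0 // sumr_ge0.
  by apply: ltr_wpDr.
apply/ler_addgt0Pr => e e0.
(* The bound [2^-1] serves for [(1 - h)^-1 <= 2], the bound [e / C] for [h * C <= e]. *)
pose h : R := Num.min 2^-1 (e / C).
have h0 : 0 < h by rewrite lt_min divr_gt0 // andbT invr_gt0.
have h2 : h <= 2^-1 by rewrite ge_min lexx.
have h1 : h < 1 by apply: le_lt_trans h2 _; lra.
have hC : h * C <= e by rewrite -ler_pdivlMr // ge_min lexx orbT.
have [_ [t _ <-] ht] := sup_adherent (exprn_gt0 2 h0) Esup.
have tmax t' : tilted_loglik t' <= tilted_loglik t + h ^+ 2.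
  have : tilted_loglik t' <= sup E.
    by apply: ub_le_sup; [exists 0|exists t'].
  by move: ht; lra.
(* Zero exponents recover the original law, whose total mass is 1. *)
have L0 : tilted_loglik (fun=> 0) = \sum_(j < m) ln (p (X j)).
  rewrite /tilted_loglik [X in _ + X - _]big1; last by move=> i _; rewrite mulr0.
  rewrite addr0; suff -> : g (fun=> 0) set0 = 1 by rewrite ln1 mulr0 subr0.
  case: pK => _ <- _; rewrite /tilted_mass; apply: eq_big => [Y|Y _].
    by rewrite sub0set.
  by rewrite big1 ?mulr1 // => k _; rewrite expR0.
have marg i : a i * (ln (g t [set i]) - ln (g t set0)) <=
    a i * ln (a i / m%:R) + (h + 2 * (a i * h)).
  have [->|ai] := posnP (occurrences X i); first by rewrite !mul0r; lra.
  have a0 : 0 < a i :> R by rewrite ltr0n.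
  have /existsP[j iXj] : [exists j, i \in X j].
    by move: ai; rewrite /occurrences => /card_gt0P[j jX]; apply/existsP; exists j.
  have gi : 0 < g t [set i].
    by apply: (tilted_mass_gt0 pK (Z_gt0 t) (pX j)); rewrite sub1set.
  rewrite -ln_div ?posrE //; set mu := g t [set i] / _.
  have mu0 : 0 < mu by exact: divr_gt0.
  have h1' : 0 < 1 - h by rewrite subr_gt0.
  have am0 : 0 < a i / m%:R :> R by exact: divr_gt0.
  (* Chosen so that [h + a i / (1 - h) = a i * (1 + x)], making [x] the relative error of the
     marginal. *)
  pose x := h / a i + h / (1 - h).
  have x0 : 0 < x by rewrite addr_gt0 ?divr_gt0.
  have x1 : 0 < 1 + x by exact: addr_gt0.
  have mux : mu <= a i / m%:R * (1 + x).
    have := near_max_marginal i h0 h1 tmax; rewrite -/mu mulrC -ler_pdivlMr //.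
    have -> // : (h + a i / (1 - h)) / m%:R = a i / m%:R * (1 + x).
    by rewrite /x; field; rewrite !lt0r_neq0.
  have lnmu : ln mu <= ln (a i / m%:R) + x.
    apply: (@le_trans _ _ (ln (a i / m%:R * (1 + x)))).
      by rewrite ler_ln // posrE; exact: mulr_gt0.
    rewrite lnM ?posrE // lerD2l; apply: le_ln1Dx.
    by apply: lt_trans x0; rewrite ltrN10.
  apply: (le_trans (ler_wpM2l (ltW a0) lnmu)); rewrite mulrDr lerD2l /x mulrDr.
  rewrite mulrC divfK ?lt0r_neq0 // lerD2l [leRHS]mulrCA ler_wpM2l ?(ltW a0) //.
  by rewrite ler_pdivrMr //; nra.
have := tmax (fun=> 0); rewrite L0 => /le_trans; apply.
apply: (@le_trans _ _ (\sum_(i < N) (a i * ln (a i / m%:R) +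
  (h + 2 * (a i * h))) + h ^+ 2)).
  rewrite lerD2r; apply: (le_trans (tilted_loglik_le t)).
  by apply: ler_sum => i _; exact: marg.
rewrite big_split /= -addrA lerD2l.
apply: le_trans hC; rewrite big_split /= sumr_const card_ord -mulr_sumr -mulr_suml.
by rewrite -mulr_natl /C expr2; nra.
Qed.

End KeyBound.

Lemma ln_prod (R : realType) (I : Type) (r : seq I) (P : pred I) (F : I -> R) :
  (forall i, P i -> 0 < F i) ->
  ln (\prod_(i <- r | P i) F i) = \sum_(i <- r | P i) ln (F i).
Proof.
move=> F0; rewrite -[RHS]expRK expR_sum; congr ln.
by apply: eq_bigr => i Pi; rewrite lnK // posrE F0.
Qed.

(** * Diagonal kernels as product laws *)

Section DiagonalDPP.
Variables (R : realType) (N : nat) (q : 'I_N -> R).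
Hypothesis q01 : forall i, 0 <= q i <= 1.

Definition product_law : {ffun {set 'I_N} -> R} :=
  [ffun Y : {set 'I_N} => \prod_(i < N) (if i \in Y then q i else 1 - q i)].

Lemma product_law_supset (S : {set 'I_N}) :
  \sum_(Y : {set 'I_N} | S \subset Y) product_law Y = \prod_(i in S) q i.
Proof.
(* A factor 0 for omitting an element of [S] turns the restricted sum into one over all sets, which
   factors by coordinate. *)
transitivity (\sum_(Y in {set 'I_N})
    \prod_(i < N) (if i \in Y then q i else if i \in S then 0 else 1 - q i)).
  rewrite big_mkcond /=; apply: eq_bigr => Y _; case: ifPn => SY.
    rewrite ffunE; apply: eq_bigr => i _; case: ifPn => // iY.
    by rewrite (contraNF (subsetP SY i)).
  have /subsetPn[i iS iY] := SY.
  by rewrite (bigD1 i) //= (negPf iY) iS mul0r.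
rewrite -bigA_distr /= [RHS]big_mkcond; apply: eq_bigr => i _.
by case: ifP => _; rewrite ?addr0 // addrC subrK.
Qed.

Lemma is_dpp_diag_mx : is_dpp (diag_mx (\row_i q i)) product_law.
Proof.
split => [Y||S].
- rewrite ffunE; apply: prodr_ge0 => i _.
  by have /andP[? ?] := q01 i; case: ifP; rewrite ?subr_ge0.
- have := product_law_supset set0; rewrite big_set0 => <-.
  by apply: eq_bigl => Y; rewrite sub0set.
- rewrite product_law_supset.
  have -> : principal_submx (diag_mx (\row_i q i)) S =
      diag_mx (\row_(k < #|S|) q (enum_val k)).
    by apply/matrixP => k l; rewrite !mxE (inj_eq enum_val_inj).
  by rewrite det_diag big_enum_val; apply: eq_bigr => k _; rewrite mxE.
Qed.

Lemma dpp_diag_mx : dpp (diag_mx (\row_i q i)) = product_law.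
Proof.
apply: xget_unique; first exact: is_dpp_diag_mx.
by move=> p pK; apply: is_dpp_unique pK is_dpp_diag_mx.
Qed.

End DiagonalDPP.

(** * Scalar entropy estimates *)

Definition nxlnx (R : realType) (x : R) : R := - (x * ln x).

Section Bounds.
Variable R : realType.
Implicit Types q b : R.

Lemma nxlnx_ge0 q : 0 <= q <= 1 -> 0 <= nxlnx q.
Proof.
move=> /andP[q0 q1]; rewrite /nxlnx oppr_ge0.
by apply: mulr_ge0_le0 => //; exact: ln_le0.
Qed.

(** For [q < 1] this is [ln (1 + u) <= u] at [u = q / (1 - q)]. *)
Lemma nxlnx_compl_le q : 0 <= q <= 1 -> nxlnx (1 - q) <= q.
Proof.
move=> /andP[q0]; rewrite le_eqVlt => /predU1P[->|q1].
  by rewrite subrr /nxlnx mul0r oppr0.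
have q1' : 0 < 1 - q by rewrite subr_gt0.
rewrite /nxlnx -mulrN -lnV ?posrE // mulrC -ler_pdivlMr //.
rewrite [X in ln X](_ : _ = 1 + q / (1 - q)); last by field; rewrite lt0r_neq0.
apply: le_ln1Dx; apply: lt_le_trans (_ : 0 <= _); first by rewrite ltrN10.
by rewrite divr_ge0 // ltW.
Qed.

(** The second term is at most [q], and [q <= b] gives [ln b^-1 <= ln q^-1] when [q] is positive. *)
Lemma entropy_le_bounded b q : 0 < b < 1 -> 0 <= q <= b ->
  nxlnx q + nxlnx (1 - q) <= (1 + (ln b^-1)^-1) * nxlnx q.
Proof.
move=> /andP[b0 b1] /andP[q0 qb].
have q1 : q <= 1 by apply: le_trans qb (ltW b1).
rewrite mulrDl mul1r lerD2l.
apply: le_trans (nxlnx_compl_le _) _; first by rewrite q0.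
have lb : 0 < ln b^-1 by rewrite ln_gt0 // invf_gt1.
rewrite mulrC ler_pdivlMr //.
move: q0; rewrite le_eqVlt => /predU1P[<-|q0]; first by rewrite /nxlnx !mul0r oppr0.
rewrite /nxlnx -mulrN ler_pM2l // -lnV ?posrE //.
by rewrite ler_ln ?posrE ?invr_gt0 // lef_pV2.
Qed.

(* Concavity of [ln] between [b] and [1]. *)
Lemma ln_ge_chord b q : 0 < b < 1 -> b <= q <= 1 ->
  (1 - q) / (1 - b) * ln b <= ln q.
Proof.
move=> /andP[b0 b1] /andP[bq q1].
have b1' : 0 < 1 - b by rewrite subr_gt0.
have s0 : 0 <= (1 - q) / (1 - b) by rewrite divr_ge0 ?subr_ge0 // ltW.
have s1 : (1 - q) / (1 - b) <= 1 by rewrite ler_pdivrMr // mul1r lerD2l lerN2.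
have := @concave_ln R (Itv01 s0 s1) b 1 b0 ltr01.
rewrite !convRE /= /unstable.onem ln1 mulr0 addr0.
by congr (_ <= ln _); field; rewrite lt0r_neq0.
Qed.

(** A frequency below 1 leaves [1 - q >= m^-1], so the chord from [m^-1] to 1 gives
    [- ln (1 - q) <= q * B * ln m] with [B = (1 - m^-1)^-1]; conclude by [1 - q <= - ln q]. *)
Lemma entropy_le_nat (a m : nat) (q := a%:R / m%:R : R) :
  (0 < m)%N -> (a <= m)%N ->
  nxlnx q + nxlnx (1 - q) <= (1 + (1 + (m%:R - 1)^-1) * ln m%:R) * nxlnx q.
Proof.
move=> m0 am.
have m0' : 0 < m%:R :> R by rewrite ltr0n.
have q01 : 0 <= q <= 1.
  by rewrite divr_ge0 //= ler_pdivrMr // mul1r ler_nat.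
have /andP[q0 q1] := q01.
rewrite mulrDl mul1r lerD2l.
(* At [q = 0] and [q = 1] both sides vanish. This covers [m = 1], where [(m%:R - 1)^-1] takes its
   default value 0. *)
have [a0|a0] := posnP a.
  by rewrite /nxlnx /q a0 !mul0r subr0 ln1 mulr0 oppr0 mulr0.
have [eam|neq] := eqVneq a m.
  by rewrite /nxlnx /q eam divff ?lt0r_neq0 // subrr ln1 mul0r !mulr0 oppr0 mulr0.
have ltam : (a < m)%N by rewrite ltn_neqAle neq.
have m1 : (1 < m)%N by apply: leq_trans ltam.
have m1' : 1 < m%:R :> R by rewrite ltr1n.
have qpos : 0 < q by rewrite divr_gt0 // ltr0n.
have qlt1 : q < 1 by rewrite ltr_pdivrMr // mul1r ltr_nat.
have mb : (m%:R^-1 : R) <= 1 - q <= 1.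
  rewrite gerBl q0 andbT /q -[X in X - _](divff (lt0r_neq0 m0')) -mulrBl.
  rewrite -[leLHS]mul1r ler_wpM2r ?invr_ge0 ?ler0n //.
  by rewrite -natrB // ler1n subn_gt0.
have mb1 : 0 < (m%:R^-1 : R) < 1 by rewrite invr_gt0 m0' invf_lt1.
have := ln_ge_chord mb1 mb.
rewrite lnV ?posrE // opprB addrCA subrr addr0 => chord.
have -> : 1 + (m%:R - 1)^-1 = (1 - m%:R^-1)^-1 :> R.
  by field; rewrite subr_eq0 !lt0r_neq0 //= ?gt_eqF.
have lq : 1 - q <= - ln q.
  by have := @le_ln1Dx R (q - 1); rewrite addrCA subrr addr0; lra.
set B := (1 - m%:R^-1)^-1 in chord *.
have B0 : 0 <= B.
  by rewrite /B invr_ge0 subr_ge0 ltW //; case/andP: mb1.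
have L0 : 0 <= ln m%:R :> R by rewrite ln_ge0 // ltW.
apply: (@le_trans _ _ ((1 - q) * (q * B * ln m%:R))).
  by rewrite /nxlnx -mulrN ler_wpM2l ?subr_ge0 //; move: chord; lra.
rewrite /nxlnx [leLHS](_ : _ = B * ln m%:R * (q * (1 - q))); last by ring.
by apply: ler_wpM2l; [exact: mulr_ge0|rewrite -[leRHS]mulrN ler_wpM2l].
Qed.
End Bounds.

Local Open Scope classical_set_scope.
Local Open Scope ring_scope.

(** * Comparison of the diagonal kernel with the optimum *)

Section Comparison.
Variables (R : realType) (N m : nat) (X : 'I_m -> {set 'I_N}).
Hypothesis m_gt0 : (0 < m)%N.

Let m_gt0R : 0 < m%:R :> R. Proof. by rewrite ltr0n. Qed.

Definition frequency (i : 'I_N) : R := (occurrences X i)%:R / m%:R.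

Lemma occurrences_compl i :
  (occurrences X i + #|[pred j | i \notin X j]|)%N = m.
Proof. by rewrite -[RHS]card_ord -(cardC [pred j | i \in X j]). Qed.

Lemma occurrences_le i : (occurrences X i <= m)%N.
Proof. by rewrite -[leqRHS]card_ord max_card. Qed.

Lemma frequency01 i : 0 <= frequency i <= 1.
Proof. by rewrite divr_ge0 //= ler_pdivrMr // mul1r ler_nat occurrences_le. Qed.

Lemma log_likelihood_diagonal :
  log_likelihood X (diagonal_kernel R X) =
  (\sum_(i < N) (nxlnx (frequency i) + nxlnx (1 - frequency i)))%:E.
Proof.
rewrite /log_likelihood (dpp_diag_mx frequency01).
(* The set [X j] itself shows that [i] occurs at least once, or is missing at least once, so no
   logarithm is [-oo]. *)
have fac_gt0 j i : 0 < (if i \in X j then frequency i else 1 - frequency i).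
  case: ifPn => iX.
    rewrite divr_gt0 // ltr0n; apply/card_gt0P; by exists j.
  rewrite subr_gt0 ltr_pdivrMr // mul1r ltr_nat.
  by rewrite -[ltnRHS](occurrences_compl i) -[ltnLHS]addn0 ltn_add2l; apply/card_gt0P; exists j; rewrite !inE.
under eq_bigr => j _.
  rewrite lne_EFin; last by rewrite ffunE; apply: prodr_gt0.
  rewrite ffunE ln_prod //.
  over.
rewrite sumEFin -EFinM -EFinN; congr (_%:E).
rewrite exchange_big mulr_sumr -sumrN /=; apply: eq_bigr => i _.
rewrite (bigID (fun j => i \in X j)) /=.
rewrite (eq_bigr (fun=> ln (frequency i))); last by move=> j ->.
rewrite [X in _ + X](eq_bigr (fun=> ln (1 - frequency i))); last first.
  by move=> j /negPf ->.
rewrite !sumr_const.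
have cC : #|[pred j | i \notin X j]| = (m - occurrences X i)%N.
  by rewrite -[X in (X - _)%N](occurrences_compl i) addKn.
rewrite [X in _ *+ X + _](_ : _ = occurrences X i) // [X in _ + _ *+ X]cC.
rewrite -mulr_natl -[X in _ + X]mulr_natl natrB ?occurrences_le //.
by rewrite /nxlnx /frequency; field; rewrite lt0r_neq0.
Qed.

Lemma opt_log_likelihood_ge :
  ((\sum_(i < N) nxlnx (frequency i))%:E <= opt_log_likelihood R X)%E.
Proof.
apply/ereal_infP => _ [K [Ksym _] <-]; rewrite /log_likelihood.
(* A training set of probability 0 makes the cost of [K] equal to [+oo]. *)
have [/forallP pX|/forallPn[j]] := boolP [forall j, 0 < dpp K (X j)]; last first.
  rewrite -leNgt => pX.
  have -> : (\sum_(j < m) lne (dpp K (X j))%:E = -oo)%E.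
    apply/esum_eqNyP; exists j; split => //; apply: le0_lneNy.
    by rewrite lee_fin.
  by rewrite gt0_muleNy ?lte_fin ?invr_gt0 // leey.
(* Positive probabilities exclude the default value 0 of [dpp], so [dpp K] is the DPP of [K]. *)
have pK : is_dpp K (dpp K).
  apply: xgetPex; apply: contrapT => /forallNP noK.
  by have := pX (Ordinal m_gt0); rewrite /dpp xgetPN // ffunE ltxx.
under [X in (_ <= - (_ * X))%E]eq_bigr do rewrite lne_EFin //.
rewrite sumEFin -EFinM -EFinN lee_fin.
rewrite /nxlnx sumrN lerN2.
have minv : 0 <= m%:R^-1 :> R by rewrite invr_ge0.
apply: (le_trans (ler_wpM2l minv (sum_ln_dpp_le Ksym pK m_gt0 pX))).
rewrite mulr_sumr; apply: ler_sum => i _.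
by rewrite mulrCA mulrA.
Qed.

Lemma sum_nxlnx_ge0 : 0 <= \sum_(i < N) nxlnx (frequency i).
Proof. by apply: sumr_ge0 => i _; apply: nxlnx_ge0; exact: frequency01. Qed.

Lemma log_likelihood_diagonal_le (c : R) : 0 <= c ->
  (forall i, nxlnx (frequency i) + nxlnx (1 - frequency i) <=
             c * nxlnx (frequency i)) ->
  (log_likelihood X (diagonal_kernel R X) <= c%:E * opt_log_likelihood R X)%E.
Proof.
move=> c0 H; rewrite log_likelihood_diagonal.
apply: (@le_trans _ _ (c%:E * (\sum_(i < N) nxlnx (frequency i))%:E)%E).
  by rewrite -EFinM lee_fin mulr_sumr; apply: ler_sum => i _; exact: H.
by apply: lee_wpmul2l; rewrite ?lee_fin // opt_log_likelihood_ge.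
Qed.

Lemma frequency_le_max i : frequency i <= (max_occurrences X)%:R / m%:R.
Proof.
by rewrite ler_pM2r ?invr_gt0 // ler_nat; exact: leq_bigmax.
Qed.

Lemma max_occurrences_le : (max_occurrences X <= m)%N.
Proof. by apply/bigmax_leqP => i _; exact: occurrences_le. Qed.

(** The free bound [b] will be the maximal frequency itself in one application and [C / N] in the
    other. *)
Lemma log_likelihood_diagonal_le_bound (b : R) : 0 < b < 1 ->
  (max_occurrences X)%:R / m%:R <= b ->
  (log_likelihood X (diagonal_kernel R X) <=
   (1 + (ln b^-1)^-1)%:E * opt_log_likelihood R X)%E.
Proof.
move=> b01 maxb; have /andP[b0 b1] := b01.
have lb : 0 < ln b^-1 by rewrite ln_gt0 // invf_gt1.
apply: log_likelihood_diagonal_le => [|i].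
  by rewrite addr_ge0 // invr_ge0 ltW.
apply: entropy_le_bounded => //; have /andP[-> _] := frequency01 i.
exact: le_trans (frequency_le_max i) maxb.
Qed.

Lemma log_likelihood_diagonal_le_max :
  (log_likelihood X (diagonal_kernel R X) <=
   (1 + (lne (m%:R%:E / (max_occurrences X)%:R%:E))^-1) *
   opt_log_likelihood R X)%E.
Proof.
(* With no occurrences the quotient and its logarithm are [+oo], so the factor is 1 and the diagonal
   cost is 0. *)
have [a0|a0] := posnP (max_occurrences X).
  rewrite a0 inve0 gt0_muley ?lte_fin // /lne invey adde0.
  apply: log_likelihood_diagonal_le => // i.
  suff -> : frequency i = 0.
    by rewrite /nxlnx mul0r subr0 ln1 mulr0 !oppr0 mulr0 addr0.
  apply/eqP; rewrite eq_le; have /andP[-> _] := frequency01 i.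
  by rewrite andbT (le_trans (frequency_le_max i)) // a0 mul0r.
have a0R : 0 < (max_occurrences X)%:R :> R by rewrite ltr0n.
rewrite inver (gt_eqF a0R) -EFinM lne_EFin ?divr_gt0 //.
(* If some element lies in every training set, the logarithm is 0 and the factor is [+oo]. A
   positive entropy sum then makes the right side [+oo]; a zero sum forces all frequencies to be 0
   or 1, hence zero diagonal cost. *)
have := max_occurrences_le; rewrite leq_eqVlt => /predU1P[am|am].
  rewrite am divff ?lt0r_neq0 // ln1 inve0 addey // log_likelihood_diagonal.
  have := opt_log_likelihood_ge; have := sum_nxlnx_ge0.
  rewrite le_eqVlt => /predU1P[E0|E0] optE.
    have fr i : nxlnx (frequency i) = 0.
      have := esym E0; move/eqP; rewrite psumr_eq0 => [/allP/(_ i)|k _].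
        by rewrite mem_index_enum => /(_ isT)/eqP.
      exact/nxlnx_ge0/frequency01.
    rewrite big1; first by apply: mule_ge0 => //; move: optE; rewrite -E0.
    move=> i _; rewrite fr add0r; have := fr i; rewrite /nxlnx.
    move/eqP; rewrite oppr_eq0 mulf_eq0 => /orP[/eqP ->|].
      by rewrite subr0 ln1 mulr0 oppr0.
    have /andP[f0 f1] := frequency01 i.
    have [-> _|f0' lf] := eqVneq (frequency i) 0.
      by rewrite subr0 ln1 mulr0 oppr0.
    have -> : frequency i = 1.
      by apply/eqP; rewrite -ln_eq0 // lt0r f0' f0.
    by rewrite subrr mul0r oppr0.
  rewrite gt0_mulye ?leey //; apply: lt_le_trans optE.
  by rewrite lte_fin.
have ma : 0 < ((max_occurrences X)%:R / m%:R : R) < 1.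
  by rewrite divr_gt0 //= ltr_pdivrMr // mul1r ltr_nat.
have := log_likelihood_diagonal_le_bound ma (lexx _); rewrite invf_div.
rewrite inver gt_eqF //; rewrite ln_gt0 // ltr_pdivlMr // mul1r ltr_nat //.
Qed.

End Comparison.

Theorem theorem8p1 (R : realType) :
  [/\ (forall (N m : nat) (X : 'I_m -> {set 'I_N}), (0 < m)%N ->
         (log_likelihood X (diagonal_kernel R X) <=
          (1 + (lne (m%:R%:E / (max_occurrences X)%:R%:E))^-1) *
          opt_log_likelihood R X)%E),
      (forall C : R, 0 < C ->
         exists2 eps : nat -> R, eps n @[n --> \oo] --> 0 &
           \forall N \near \oo,
             forall (m : nat) (X : 'I_m -> {set 'I_N}), (0 < m)%N ->
               (max_occurrences X)%:R <= C * m%:R / N%:R ->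
               (log_likelihood X (diagonal_kernel R X) <=
                (1 + (1 + eps N) / ln N%:R)%:E * opt_log_likelihood R X)%E)
    & (forall (N m : nat) (X : 'I_m -> {set 'I_N}), (0 < m)%N ->
         (log_likelihood X (diagonal_kernel R X) <=
          (1 + (1 + (m%:R - 1)^-1) * ln m%:R)%:E * opt_log_likelihood R X)%E)].
Proof.
split.
- by move=> N m X m0; exact: log_likelihood_diagonal_le_max.
(* This [eps] solves [(1 + eps) / ln N = (ln N - ln C)^-1], the right side being the excess obtained
   from [b = C / N]. *)
- move=> C C0; exists (fun n => ln C * (ln n%:R - ln C)^-1).
    rewrite -[X in _ --> X](mulr0 (ln C)); apply: cvgMl_tmp.
    have lny : ln n%:R - ln C @[n --> \oo] --> +oo.
      apply/cvgryPge => A; near=> n; rewrite lerBrDr.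
      have n1 : expR (A + ln C) <= n%:R by near: n; exact: nbhs_infty_ger.
      by rewrite -ler_expR lnK // posrE (lt_le_trans _ n1) ?expR_gt0.
    apply/(gtr0_cvgV0 _).2 => //; near=> n.
    have : 1 <= ln n%:R - ln C.
      by near: n; move/cvgryPge : lny; apply.
    by apply: lt_le_trans.
  near=> N => m X m0 maxC.
  have N1 : 1 < N%:R :> R by near: N; exact: nbhs_infty_gtr.
  have NC : C < N%:R by near: N; exact: nbhs_infty_gtr.
  have N0 : 0 < N%:R :> R by apply: lt_trans N1.
  have b01 : 0 < C / N%:R < 1 by rewrite divr_gt0 //= ltr_pdivrMr // mul1r.
  have m0R : 0 < m%:R :> R by rewrite ltr0n.
  have maxb : (max_occurrences X)%:R / m%:R <= C / N%:R.
    by rewrite ler_pdivrMr // mulrAC.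
  have := log_likelihood_diagonal_le_bound m0 b01 maxb.
  rewrite invf_div ln_div ?posrE //.
  suff -> : (1 + ln C * (ln N%:R - ln C)^-1) / ln N%:R = (ln N%:R - ln C)^-1 by [].
  have lN : 0 < ln N%:R :> R by rewrite ln_gt0.
  have lNC : 0 < ln N%:R - ln C by rewrite subr_gt0 ltr_ln ?posrE.
  by field; rewrite !lt0r_neq0.
- move=> N m X m0; apply: log_likelihood_diagonal_le => // [|i].
    have m1 : 0 <= m%:R - 1 :> R by rewrite subr_ge0 ler1n.
    by rewrite addr_ge0 // mulr_ge0 ?addr_ge0 ?invr_ge0 // ln_ge0 // ler1n.
  by apply: entropy_le_nat => //; exact: occurrences_le.
Unshelve. all: by end_near. Qed.
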